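(* Let $\delta_0,\rho>0$ and let $G_n=\nabla g(\theta_n)+\varepsilon_n$ with $\mathbb E[\varepsilon_n\mid\mathscr F_{n-1}]=0$ for every $n\ge1$. Suppose there are constants $M_{2+\rho}<\infty$ and $v_0>0$ such that, for every $n$, almost surely on the event $\mathcal L_n:=\{\|\nabla g(\theta_n)\|\le\delta_0\}$, $$\mathbb E[\|\varepsilon_n\|^{2+\rho}\mid\mathscr F_{n-1}]\le M_{2+\rho}\qquad\text{and}\qquad \mathbb E[\|\varepsilon_n\|^2\mid\mathscr F_{n-1}]\ge v_0 .$$ Then the local conditional relative-moment condition holds: there is $\kappa_\rho<\infty$ such that, almost surely for every $n$, $$\mathbf 1_{\mathcal L_n}\mathbb E[\|G_n\|^{2+\rho}\mid\mathscr F_{n-1}]\le\kappa_\rho\mathbf 1_{\mathcal L_n}\mathbb E[\|G_n\|^2\mid\mathscr F_{n-1}].$$ In particular, the condition holds when, conditionally on $\mathscr F_{n-1}$, $\varepsilon_n$ is a centered Gaussian vector whose conditional covariance matrix is uniformly bounded in $n$ and has trace bounded below by a positive constant on $\mathcal L_n$.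
   Context: $g:\mathbb R^d\to\mathbb R$ is continuously differentiable. $\{\mathscr F_n\}_{n\ge0}$ is a filtration on a probability space; for each $n\ge1$, $\theta_n\in\mathbb R^d$ is $\mathscr F_{n-1}$-measurable and $G_n$ is $\mathscr F_n$-measurable. $\|\cdot\|$ is the Euclidean norm. *)

(* Defs.v *)
From HB Require Import structures.
From mathcomp Require Import all_boot all_order all_algebra.
From mathcomp Require Import all_classical all_reals all_analysis.
From mathcomp Require Import measurable_realfun.

Set Implicit Arguments.
Unset Strict Implicit.
Unset Printing Implicit Defensive.
Import Order.TTheory GRing.Theory Num.Theory.
Import numFieldNormedType.Exports.

Local Open Scope classical_set_scope.
Local Open Scope ring_scope.

Section euclidean_space.
Context {R : realType} {d : nat}.
Implicit Types (g : 'rV[R]_d -> R) (x : 'rV[R]_d).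

(* The Euclidean norm; `|x| on 'rV[R]_d is the sup norm. *)
Definition enorm x : R := Num.sqrt (\sum_(i < d) x 0 i ^+ 2).

Definition grad g x : 'rV[R]_d := \row_(i < d) 'D_(delta_mx 0 i) g x.

Definition continuously_differentiable g :=
  (forall x, differentiable g x) /\ continuous (grad g).

End euclidean_space.

Notation borel_rV R d := (g_sigma_algebraType (@open 'rV[R]_d)).

Section conditioning.
Context {disp : measure_display} {T : measurableType disp} {R : realType}.
Variable P : probability T R.
Implicit Types (F : set (set T)) (X Y : T -> \bar R).
Local Open Scope ereal_scope.

Definition is_sub_sigma_algebra F :=
  sigma_algebra [set: T] F /\ F `<=` @measurable _ T.

Definition filtration (F : nat -> set (set T)) :=
  (forall n, is_sub_sigma_algebra (F n)) /\
  (forall m n, (m <= n)%N -> F m `<=` F n).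

Definition measurable_wrt F {disp'} {U : measurableType disp'} (f : T -> U) :=
  measurable_fun [set: g_sigma_algebraType F]
    (f : g_sigma_algebraType F -> U).

(* Y is a version of E[X | F]. Meaningful for X integrable (Y is then
   integrable) and for X measurable and nonnegative, possibly with infinite
   expectation (Y is then a.s. nonnegative, possibly infinite). *)
Definition is_cond_exp F X Y :=
  measurable_wrt F Y /\
  forall A, F A -> \int[P]_(w in A) Y w = \int[P]_(w in A) X w.

(* A chosen version of E[X | F]; see cond_expP for existence. *)
Definition cond_exp F X : T -> \bar R :=
  xget (cst 0) [set Y | is_cond_exp F X Y].

Section existence.
Variable F : set (set T).
Hypothesis sF : is_sub_sigma_algebra F.

Let mF : @measurable _ (g_sigma_algebraType F) = F.
Proof. by case: sF => /measurable_g_measurableTypeE. Qed.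

Let mid : measurable_fun [set: T] (idfun : T -> g_sigma_algebraType F).
Proof. by move=> _ A; rewrite mF setTI; apply: sF.2. Qed.

Lemma measurable_wrtW d' (U : measurableType d') (f : T -> U) :
  measurable_wrt F f -> measurable_fun [set: T] f.
Proof. by move=> mf; exact: (measurableT_comp mf mid). Qed.

Let idm : {mfun T >-> g_sigma_algebraType F} :=
  HB.pack (idfun : T -> g_sigma_algebraType F)
    (isMeasurableFun.Build _ _ _ _ _ mid).

Let Q : probability (g_sigma_algebraType F) R := distribution P idm.

Section ge0_integrable.
Variable X : T -> \bar R.
Hypotheses (X0 : forall w, 0 <= X w) (iX : P.-integrable [set: T] X).

Let nu (A : set (g_sigma_algebraType F)) := \int[P]_(w in A) X w.

Let nu0 : nu set0 = 0. Proof. exact: integral_set0. Qed.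
Let nu_ge0 A : 0 <= nu A. Proof. by apply: integral_ge0. Qed.
Let nu_sigma : semi_sigma_additive nu.
Proof.
move=> /= A mA tA mUA; apply: semi_sigma_additive_nng_induced => //.
- exact: measurable_int iX.
- by move=> n; apply: sF.2; rewrite -mF.
- by apply: sF.2; rewrite -mF.
Qed.
Let nu_measure : {measure set (g_sigma_algebraType F) -> \bar R} :=
  HB.pack nu (isMeasure.Build _ _ _ nu nu0 nu_ge0 nu_sigma).
Let nu_fin : fin_num_fun nu_measure.
Proof.
move=> A; rewrite mF => /sF.2 mA.
by apply: integrable_fin_num => //; exact: integrableS iX.
Qed.
Let nu_finite : {finite_measure set (g_sigma_algebraType F) -> \bar R} :=
  HB.pack (Measure.sort nu_measure)
    (Measure_isFinite.Build _ _ _ nu_measure nu_fin).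

Lemma is_cond_exp_ge0_integrable : exists Y,
  [/\ is_cond_exp F X Y, P.-integrable [set: T] Y & forall w, 0 <= Y w].
Proof.
have mX : measurable_fun [set: T] X by exact: measurable_int iX.
have numQ : nu_finite `<< Q.
  apply/null_content_dominatesP => A mA QA.
  apply: null_set_integral => //.
    by apply: sF.2; rewrite -mF.
  by apply: measurable_funTS.
have [Y [Y0 Yfin iY YE]] := radon_nikodym_sigma_finite numQ.
have mY : measurable_fun [set: g_sigma_algebraType F] Y.
  exact: measurable_int iY.
have YP A : F A -> \int[P]_(w in A) Y w = \int[P]_(w in A) X w.
  move=> FA; rewrite -[RHS]/(nu_finite A) YE ?mF//.
  rewrite ge0_integral_pushforward ?mF//; exact: measurable_funTS.
exists Y; split => //.
apply/integrableP; split; first exact: measurable_wrtW.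
under eq_integral do rewrite gee0_abs//.
rewrite YP; last by rewrite -mF; exact: measurableT.
by case/integrableP : iX => _; under eq_integral do rewrite gee0_abs//.
Qed.

End ge0_integrable.

Lemma is_cond_exp_integrable X : P.-integrable [set: T] X ->
  exists Y, is_cond_exp F X Y.
Proof.
move=> iX.
have [Yp [[mYp Ypint] iYp _]] :=
  is_cond_exp_ge0_integrable (funepos_ge0 X) (integrable_funepos measurableT iX).
have [Yn [[mYn Ynint] iYn _]] :=
  is_cond_exp_ge0_integrable (funeneg_ge0 X) (integrable_funeneg measurableT iX).
exists (Yp \- Yn); split; first exact: emeasurable_funB.
move=> A FA; have mA : measurable A by exact: sF.2.
rewrite [RHS]integralE integralB// ?Ypint ?Ynint//.
  exact: integrableS iYp.
exact: integrableS iYn.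
Qed.

Lemma is_cond_exp_ge0 X : (forall w, 0 <= X w) ->
  measurable_fun [set: T] X -> exists Y, is_cond_exp F X Y.
Proof.
move=> X0 mX.
pose m n w := mine (X w) n%:R%:E.
have mfin n w : m n w \is a fin_num.
  rewrite /m ge0_fin_numE; last by rewrite le_min X0 lee_fin ler0n.
  by apply: (@le_lt_trans _ _ n%:R%:E); rewrite ?ltry// ge_min lexx orbT.
pose D n w := m n.+1 w - m n w.
have D0 n w : 0 <= D n w.
  by rewrite sube_ge0 ?mfin// /m le_min2// lee_fin ler_nat.
have mm n : measurable_fun [set: T] (m n) by exact: measurable_mine.
have mD n : measurable_fun [set: T] (D n) by exact: emeasurable_funB.
have im n : P.-integrable [set: T] (m n).
  apply: (@le_integrable _ _ _ P _ _ _ (cst n%:R%:E)) => //.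
    move=> w _ /=; rewrite /m gee0_abs ?le_min ?X0 ?lee_fin ?ler0n//.
    by rewrite ger0_norm// ge_min lexx orbT.
  exact: finite_measure_integrable_cst.
have iD n : P.-integrable [set: T] (D n) by exact: integrableB.
have DX w : \sum_(0 <= n <oo) D n w = X w.
  apply/cvg_lim => //.
  have -> : (fun n => \sum_(0 <= k < n) D k w) = m ^~ w.
    apply/funext => n; rewrite telescope_sume// /m.
    by rewrite [X in _ - X]min_r ?sube0.
  rewrite /m; case: (X w) (X0 w) => [r r0| _|//].
    apply: cvg_near_cst; near=> n; rewrite min_l// lee_fin.
    by near: n; exact: nbhs_infty_ger.
  under eq_fun do rewrite min_r ?leey//.
  exact/cvgenyP.
have [Y YP] := choice (fun n => is_cond_exp_ge0_integrable (D0 n) (iD n)).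
exists (fun w => \sum_(0 <= n <oo) Y n w); split.
  apply: ge0_emeasurable_sum => [n w _ _|n _]; first by have [_ _] := YP n.
  by have [[]] := YP n.
move=> A FA; have mA : measurable A by exact: sF.2.
rewrite integral_nneseries//; last 2 first.
  by move=> n; have [[/measurable_wrtW + _] _ _] := YP n; exact: measurable_funTS.
  by move=> n w _; have [_ _] := YP n.
under [RHS]eq_integral do rewrite -DX.
rewrite integral_nneseries//; last by move=> n; exact: measurable_funTS.
by apply: eq_eseriesr => n _; have [[_ ->]] := YP n.
Unshelve. all: by end_near. Qed.

Lemma cond_expP X :
  P.-integrable [set: T] X \/
    (measurable_fun [set: T] X /\ forall w, 0 <= X w) ->
  is_cond_exp F X (cond_exp F X).
Proof.
by case=> [/is_cond_exp_integrable|[mX X0]]; [|have := is_cond_exp_ge0 X0 mX];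
  case=> Y XY; exact: (xgetPex (cst 0) (ex_intro [set Y | is_cond_exp F X Y] Y XY)).
Qed.

End existence.

(* k is a regular conditional distribution of X given F. *)
Definition is_cond_law F {disp'} {U : measurableType disp'} (X : T -> U)
    (k : T -> probability U R) :=
  (forall B, measurable B -> measurable_wrt F (fun w => k w B)) /\
  forall A B, F A -> measurable B ->
    P (A `&` X @^-1` B) = \int[P]_(w in A) k w B.

End conditioning.

Definition rV_coord {R : realType} {d : nat} (i : 'I_d) (x : 'rV[R]_d) : R :=
  x 0 i.

Section gaussian.
Context {R : realType} {d : nat}.
Variable mu : probability (borel_rV R d) R.
Local Open Scope ereal_scope.

(* The degenerate case is a point mass: for s = 0 the library's normal_prob is
   the uniform law on [0, 1]. *)
Definition normal_law (m s : R) : set R -> \bar R :=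
  if s == 0%R then \d_m else normal_prob m s.

(* Every linear form has a normal law; singular covariance is allowed. *)
Definition gaussian_vector := forall u : 'rV[R]_d, exists m s : R,
  forall B : set R, measurable B ->
    mu [set x : 'rV[R]_d | B (\sum_(i < d) u ord0 i * x ord0 i)%R] =
    normal_law m s B.

Definition centered := forall i, 'E_mu[rV_coord i] = 0.

Definition cov_mx : 'M[R]_d :=
  \matrix_(i, j) fine (covariance mu (rV_coord i) (rV_coord j)).

End gaussian.

Section local_relative_moment.
Context {disp : measure_display} {T : measurableType disp} {R : realType}.
Context {d : nat}.
Variables (P : probability T R) (F : nat -> set (set T)).
Variables (g : 'rV[R]_d -> R) (theta G : nat -> T -> 'rV[R]_d).
Variables (delta0 rho : R).

Definition local_event n : set T :=
  [set w | enorm (grad g (theta n w)) <= delta0].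

(* E[X | F_(n-1)], for n >= 1. *)
Definition cond_exp_prev n (X : T -> R) : T -> \bar R :=
  cond_exp P (F n.-1) (EFin \o X).

(* Extended-real inequality, with 0 * +oo = 0 off the local event. *)
Definition local_relative_moment_condition := exists kappa : R,
  {ae P, forall w, forall n, (0 < n)%N ->
    ((\1_(local_event n) w)%:E *
       cond_exp_prev n (fun w => enorm (G n w) `^ (2 + rho))%R w <=
     kappa%:E * ((\1_(local_event n) w)%:E *
       cond_exp_prev n (fun w => enorm (G n w) ^+ 2)%R w))%E}.

End local_relative_moment.

(* Main.v *)
Require Import Defs.
From HB Require Import structures.
From mathcomp Require Import all_boot all_order all_algebra.
From mathcomp Require Import all_classical all_reals all_analysis.
From mathcomp Require Import measurable_realfun.
From mathcomp Require Import ring lra.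

Set Implicit Arguments.
Unset Strict Implicit.
Unset Printing Implicit Defensive.
Import Order.TTheory GRing.Theory Num.Theory.
Import numFieldNormedType.Exports.

Local Open Scope classical_set_scope.
Local Open Scope ring_scope.

(** On the local event the gradient [h] has norm at most [delta0], while the
    noise [e] has a conditional moment of order [p = 2 + rho] at most [M] and a
    conditional second moment at least [v]. The inequality
    [|h + e|^p <= 2^p (|h|^p + |e|^p)] bounds the conditional [p]-th moment of
    [h + e] by [2^p (delta0^p + M)]. In the conditional second moment the cross
    term vanishes, since [h] is known and [e] is centered, so that this moment is
    at least [v]. The ratio of the two bounds is the constant [kappa]
    ([cond_moment_ratio]).

    Nothing is proved about conditional expectations directly: an almost sure
    bound by a constant on an event [D] of the sigma-algebra amounts to the same
    bound for integrals over all the events contained in [D]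
    ([cond_exp_le_of_integral_le] and [cond_exp_ge_of_integral_ge], with their
    converses), and the estimates are made on integrals. The vanishing of the
    cross term is [cond_exp0_pull_out].

    In the Gaussian case, disintegration ([integral_cond_law]) turns integrals
    of functions of the noise into integrals of moments of the conditional law.
    The second moment of a centered Gaussian vector is the trace of its
    covariance matrix ([gaussian_sqr_enorm]). Its [p]-th moment is bounded in
    terms of the covariance matrix ([gaussian_enorm_powR_le]): a power of a
    coordinate is dominated by exponentials, the exponential moments of a normal
    variable follow from completing the square, and its parameter [s] is bounded
    by its second moment.

    The exchanges of integrals behind all this (pull-out, disintegration,
    densities, image laws) come from one principle, [eq_integral_mixture]: two
    mixtures of measures that agree on measurable sets integrate nonnegative
    measurable functions in the same way. *)

(** * Mixtures of measures *)

Section mixtures.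
Context {R : realType} {du : measure_display} {U : measurableType du}.
Local Open Scope ereal_scope.
Import HBNNSimple.

(** The right-hand side involves the kernel only through the numbers
    [\int[mu]_(w in D) k w B]; this is what makes the next lemma possible.
    It follows from two monotone convergences along a simple approximation. *)
Lemma integral_mixture_lim d (T : measurableType d)
    (mu : {measure set T -> \bar R}) (D : set T)
    (k : T -> {measure set U -> \bar R}) (f : U -> \bar R)
    (mf : measurable_fun [set: U] f) :
  measurable D -> (forall B, measurable B -> measurable_fun D (k ^~ B)) ->
  (forall x, 0 <= f x) ->
  \int[mu]_(w in D) \int[k w]_x f x =
  limn (fun n => let h := nnsfun_approx measurableT mf n in
    \sum_(r \in range h) r%:E * \int[mu]_(w in D) k w (h @^-1` [set r])).
Proof.
move=> mD mk f0; set h := nnsfun_approx measurableT mf.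
have hE w n : \int[k w]_x (h n x)%:E =
    \sum_(r \in range (h n)) r%:E * k w (h n @^-1` [set r]).
  by rewrite integralT_nnsfun sintegralE.
have hr_ge0 n r w : 0 <= r%:E * k w (h n @^-1` [set r]).
  exact: (mulemu_ge0 (fun r => h n @^-1` [set r])) (@preimage_nnfun0 _ _ _ _).
have mhr n r : measurable_fun D (fun w => r%:E * k w (h n @^-1` [set r])).
  by apply: measurable_funeM; exact: mk.
have ih n : \int[mu]_(w in D) \int[k w]_x (h n x)%:E =
    \sum_(r \in range (h n)) r%:E * \int[mu]_(w in D) k w (h n @^-1` [set r]).
  under eq_integral do rewrite hE.
  rewrite ge0_integral_fsum//.
  apply: eq_fsbigr => r /[!inE] -[x _ <-].
  by rewrite ge0_integralZl//; [exact: mk|rewrite lee_fin].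
under [in RHS]eq_fun do rewrite /= -ih.
rewrite -monotone_convergence//; last 3 first.
- move=> n; under eq_fun do rewrite hE.
  exact: emeasurable_fsum.
- by move=> n w _; apply: integral_ge0 => x _; rewrite lee_fin.
- move=> w _ m n mn; apply: ge0_le_integral => //.
  + by move=> x _; rewrite lee_fin.
  + exact/measurable_EFinP.
  + exact/measurable_EFinP.
  + by move=> x _; rewrite lee_fin; exact/lefP/nd_nnsfun_approx.
apply: eq_integral => w _; rewrite -monotone_convergence//; last 3 first.
- by move=> n; exact/measurable_EFinP.
- by move=> n x _; rewrite lee_fin.
- by move=> x _ m n mn; rewrite lee_fin; exact/lefP/nd_nnsfun_approx.
by apply: eq_integral => x _; apply/esym/cvg_lim => //; exact: cvg_nnsfun_approx.
Qed.

(** A mixture of kernels is determined by its values on measurable sets. This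
    is used with Dirac masses, possibly weighted, for one or both kernels, which
    turns identities between sets into identities between integrals: pulling a
    factor out of a conditional expectation, disintegration, change of
    variables, and integration against a density. *)
Lemma eq_integral_mixture d1 d2 (T1 : measurableType d1)
    (T2 : measurableType d2) (mu1 : {measure set T1 -> \bar R})
    (mu2 : {measure set T2 -> \bar R}) (D1 : set T1) (D2 : set T2)
    (k1 : T1 -> {measure set U -> \bar R})
    (k2 : T2 -> {measure set U -> \bar R}) (f : U -> \bar R) :
  measurable D1 -> measurable D2 ->
  (forall B, measurable B -> measurable_fun D1 (k1 ^~ B)) ->
  (forall B, measurable B -> measurable_fun D2 (k2 ^~ B)) ->
  (forall B, measurable B ->
    \int[mu1]_(w in D1) k1 w B = \int[mu2]_(w in D2) k2 w B) ->
  measurable_fun [set: U] f -> (forall x, 0 <= f x) ->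
  \int[mu1]_(w in D1) \int[k1 w]_x f x = \int[mu2]_(w in D2) \int[k2 w]_x f x.
Proof.
move=> mD1 mD2 mk1 mk2 k12 mf f0.
rewrite (integral_mixture_lim _ mf)// (integral_mixture_lim _ mf)//.
congr (limn _); apply/funext => n /=; apply: eq_fsbigr => r _.
by rewrite k12.
Qed.

End mixtures.

(** * Conditional expectations and bounds on events *)

Section gap.
Context {d} {T : measurableType d} {R : realType}.
Variable mu : {measure set T -> \bar R}.
Local Open Scope ereal_scope.

(** The nonnegative function [g - f] has zero integral over [A], so it vanishes
    almost everywhere there, although it is positive at every point of [A]. *)
Lemma ge0_integral_gap (A : set T) (f g : T -> \bar R) : measurable A ->
  measurable_fun A f -> measurable_fun A g ->
  (forall x, A x -> 0 <= f x) -> (forall x, A x -> f x < g x) ->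
  \int[mu]_(x in A) g x <= \int[mu]_(x in A) f x ->
  \int[mu]_(x in A) f x < +oo -> mu A = 0.
Proof.
move=> mA mf mg f0 fg gf foo.
have ffin x : A x -> f x \is a fin_num.
  by move=> Ax; rewrite ge0_fin_numE ?f0// (lt_le_trans (fg _ Ax))// leey.
have gf0 x : A x -> 0 <= g x - f x.
  by move=> Ax; rewrite sube_ge0 ?ffin//; exact/ltW/fg.
have mgf : measurable_fun A (g \- f) by exact: emeasurable_funB.
have gE : \int[mu]_(x in A) g x =
    \int[mu]_(x in A) f x + \int[mu]_(x in A) (g x - f x).
  rewrite -ge0_integralD//; apply: eq_integral => x /[!inE] Ax.
  by rewrite addeC subeK// ffin.
have ifin : \int[mu]_(x in A) f x \is a fin_num.
  by rewrite ge0_fin_numE// integral_ge0.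
have : \int[mu]_(x in A) `|g x - f x| = 0.
  apply/eqP; rewrite eq_le integral_ge0// andbT.
  under eq_integral => x /[!inE] Ax do rewrite gee0_abs ?gf0//.
  by move: gf; rewrite gE -[leRHS]adde0 leeD2lE.
move/(ae_eq_integral_abs mu mA mgf) => [N [mN N0 AN]].
apply: (subset_measure0 _ _ _ N0) => // x Ax; apply: AN => /= /(_ Ax)/eqP.
by apply/negP; rewrite gt_eqF// sube_gt0 fg.
Qed.

End gap.

Section conditional_bounds.
Context {disp : measure_display} {T : measurableType disp} {R : realType}.
Variables (P : probability T R) (F : set (set T)).
Hypothesis sF : is_sub_sigma_algebra F.
Local Open Scope ereal_scope.

Lemma sub_sigma_algebra_measurableE : @measurable _ (g_sigma_algebraType F) = F.
Proof. by case: sF => /measurable_g_measurableTypeE. Qed.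

Lemma sub_sigma_algebra_measurable A : F A -> measurable A.
Proof. exact: sF.2. Qed.

Lemma sub_sigma_algebraI A B : F A -> F B -> F (A `&` B).
Proof. by rewrite -sub_sigma_algebra_measurableE; exact: measurableI. Qed.

Lemma measurable_wrt_preimage d (U : measurableType d) (f : T -> U) B :
  measurable_wrt F f -> measurable B -> F (f @^-1` B).
Proof.
move=> mf mB; rewrite -sub_sigma_algebra_measurableE -[X in _ X]setTI.
exact: mf.
Qed.

Section nonnegative.
Variables (X Y : T -> \bar R).
Hypothesis X0 : forall w, 0 <= X w.
Hypothesis XY : is_cond_exp P F X Y.

Let mY : measurable_fun [set: T] Y := measurable_wrtW sF XY.1.

(** The definition of a version of a conditional expectation does not make it
    nonnegative: on the event where it is negative, its integral is both
    negative and equal to the nonnegative integral of [X]. *)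
Lemma cond_exp_ae_ge0 : {ae P, forall w, 0 <= Y w}.
Proof.
pose A := [set w | Y w < 0].
have FA : F A.
  rewrite (_ : A = Y @^-1` [set y | y < 0])//.
  apply: measurable_wrt_preimage; first exact: XY.1.
  by rewrite -set_itvNyo; exact: emeasurable_itv.
have mA := sub_sigma_algebra_measurable FA.
exists A; split => //; last by move=> w /= /negP; rewrite -ltNge.
apply: (@ge0_integral_gap _ _ _ P A (cst 0) (\- Y)) => //.
- by apply: measurableT_comp => //; exact: measurable_funTS.
- by move=> w; rewrite /A/= oppe_gt0.
- rewrite integral0 /=.
  have -> : \int[P]_(w in A) - Y w = - \int[P]_(w in A) Y w.
    transitivity (- \int[P]_(w in A) - - Y w); last first.
      by congr (- _); apply: eq_integral => w _; rewrite oppeK.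
    by rewrite [in RHS]integral_ge0N ?oppeK// => w /ltW; rewrite oppe_ge0.
  by rewrite XY.2// oppe_le0 integral_ge0.
- by rewrite integral0 ltry.
Qed.

Lemma integral_cond_exp_pos A : F A ->
  \int[P]_(w in A) X w = \int[P]_(w in A) Y^\+ w.
Proof.
move=> FA; have mA := sub_sigma_algebra_measurable FA.
rewrite -XY.2//; apply: ae_eq_integral => //.
- exact: measurable_funTS.
- by apply: measurable_funTS; exact: measurable_funepos.
- apply: filterS cond_exp_ae_ge0 => w Y0 _.
  by rewrite funeposE max_l.
Qed.

(** The next four lemmas exchange an almost sure bound for a conditional
    expectation on [D] with bounds for integrals of [X] over the events of [F]
    inside [D]. All the estimates on conditional moments can thus be made on
    integrals, where no exceptional set has to be tracked. *)
Variables (D : set T) (c : R).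
Hypotheses (FD : F D) (c0 : (0 <= c)%R).

Lemma integral_le_of_cond_exp_le A :
  {ae P, forall w, D w -> Y w <= c%:E} -> F A -> A `<=` D ->
  \int[P]_(w in A) X w <= c%:E * P A.
Proof.
move=> Yc FA AD; have mA := sub_sigma_algebra_measurable FA.
rewrite integral_cond_exp_pos// -integral_cst//.
apply: ae_ge0_le_integral => //.
- by apply: measurable_funTS; exact: measurable_funepos.
- apply: filterS Yc => w Yc /AD/Yc {}Yc.
  by rewrite funeposE ge_max Yc lee_fin.
Qed.

Lemma integral_ge_of_cond_exp_ge A :
  {ae P, forall w, D w -> c%:E <= Y w} -> F A -> A `<=` D ->
  c%:E * P A <= \int[P]_(w in A) X w.
Proof.
move=> Yc FA AD; have mA := sub_sigma_algebra_measurable FA.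
rewrite integral_cond_exp_pos// -integral_cst//.
apply: ae_ge0_le_integral => //.
- by apply: measurable_funTS; exact: measurable_funepos.
- apply: filterS Yc => w Yc /AD/Yc {}Yc.
  by rewrite funeposE le_max Yc.
Qed.

Lemma cond_exp_le_of_integral_le :
  (forall A, F A -> A `<=` D -> \int[P]_(w in A) X w <= c%:E * P A) ->
  {ae P, forall w, D w -> Y w <= c%:E}.
Proof.
move=> Xc; pose A := D `&` Y @^-1` [set y | c%:E < y].
have FA : F A.
  apply: sub_sigma_algebraI => //.
  apply: measurable_wrt_preimage; first exact: XY.1.
  by rewrite -set_itvoy; exact: emeasurable_itv.
have mA := sub_sigma_algebra_measurable FA.
exists A; split => //; last first.
  by move=> w /= /not_implyP[Dw /negP]; rewrite -ltNge; split.
apply: (@ge0_integral_gap _ _ _ P A (cst c%:E) Y) => //.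
- exact: measurable_funTS.
- by move=> w [].
- by rewrite integral_cst// XY.2// Xc// => w [].
- rewrite integral_cst//; apply: (@le_lt_trans _ _ (c%:E * 1)).
    by rewrite lee_wpmul2l ?lee_fin// probability_le1.
  by rewrite mule1 ltry.
Qed.

Lemma cond_exp_ge_of_integral_ge :
  (forall A, F A -> A `<=` D -> c%:E * P A <= \int[P]_(w in A) X w) ->
  {ae P, forall w, D w -> c%:E <= Y w}.
Proof.
move=> Xc; pose A := D `&` Y @^-1` [set y | y < c%:E].
have FA : F A.
  apply: sub_sigma_algebraI => //.
  apply: measurable_wrt_preimage; first exact: XY.1.
  by rewrite -set_itvNyo; exact: emeasurable_itv.
have mA := sub_sigma_algebra_measurable FA.
have cPoo : c%:E * P A < +oo.
  apply: (@le_lt_trans _ _ (c%:E * 1)).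
    by rewrite lee_wpmul2l ?lee_fin// probability_le1.
  by rewrite mule1 ltry.
(* Y is cut at 0 because the gap lemma needs a nonnegative lower function. *)
pose B := A `&` Y @^-1` [set y | 0 <= y].
have FB : F B.
  apply: sub_sigma_algebraI => //.
  apply: measurable_wrt_preimage; first exact: XY.1.
  by rewrite -set_itvcy; exact: emeasurable_itv.
have mB := sub_sigma_algebra_measurable FB.
have PB : P B = 0.
  apply: (@ge0_integral_gap _ _ _ P B Y (cst c%:E)) => //.
  - exact: measurable_funTS.
  - by move=> w [].
  - by move=> w [[]].
  - by rewrite integral_cst// XY.2// Xc// => w [[]].
  - apply: (@le_lt_trans _ _ (\int[P]_(w in B) (cst c%:E) w)).
      apply: ge0_le_integral => //; first by move=> w [].
        exact: measurable_funTS.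
      by move=> w [[_ /= /ltW]].
    rewrite integral_cst//; apply: le_lt_trans cPoo.
    by rewrite lee_wpmul2l ?lee_fin// le_measure ?inE// => w [].
have nB : {ae P, forall w, ~ B w} by exists B; split => // w /= /contrapT.
apply: filterS2 cond_exp_ae_ge0 nB => w Y0 nB Dw.
by rewrite leNgt; apply/negP => Yc; apply: nB.
Qed.

End nonnegative.

End conditional_bounds.

(** * Taking out what is known, and disintegration *)

Section weighted_dirac.
Context {R : realType} {d : measure_display} {T : measurableType d}.
Local Open Scope ereal_scope.

Definition weighted_dirac (r : {nonneg R}) (x : T) : {measure set T -> \bar R} :=
  mscale r \d_x.

Lemma weighted_diracE r x B : weighted_dirac r x B = (r%:num * \1_B x)%:E.
Proof. by rewrite /weighted_dirac/= /mscale/= /dirac EFinM. Qed.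

Lemma integral_weighted_dirac r x (f : T -> \bar R) :
  measurable_fun [set: T] f -> (forall y, 0 <= f y) ->
  \int[weighted_dirac r x]_y f y = r%:num%:E * f x.
Proof.
by move=> mf f0; rewrite ge0_integral_mscale// integral_dirac// diracT mul1e.
Qed.

End weighted_dirac.

Section pull_out.
Context {disp : measure_display} {T : measurableType disp} {R : realType}.
Variables (P : probability T R) (F : set (set T)).
Hypothesis sF : is_sub_sigma_algebra F.
Variable X : T -> R.
Hypothesis iX : P.-integrable [set: T] (EFin \o X).
Hypothesis X0 : forall A, F A -> (\int[P]_(w in A) (X w)%:E = 0)%E.

(* Mixing Dirac masses with the weights X^+ or X^- gives the same measure on F,
   as X integrates to 0 over every event of F. *)
Let Xpos w : R := Num.max (X w) 0.
Let Xneg w : R := Num.max (- X w) 0.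
Let Xpos0 w : 0 <= Xpos w. Proof. by rewrite le_max lexx orbT. Qed.
Let Xneg0 w : 0 <= Xneg w. Proof. by rewrite le_max lexx orbT. Qed.
Let mX : measurable_fun [set: T] X.
Proof. by have /measurable_int/measurable_EFinP := iX. Qed.
Let mXpos : measurable_fun [set: T] Xpos.
Proof. exact: measurable_maxr. Qed.
Let mXneg : measurable_fun [set: T] Xneg.
Proof. by apply: measurable_maxr => //; exact: measurableT_comp. Qed.

Let XposXneg A : F A ->
  (\int[P]_(w in A) (Xpos w)%:E = \int[P]_(w in A) (Xneg w)%:E)%E.
Proof.
move=> FA; have mA := sub_sigma_algebra_measurable sF FA.
have iXA : P.-integrable A (EFin \o X) by exact: integrableS iX.
have ifinp : (\int[P]_(w in A) (Xpos w)%:E)%E \is a fin_num.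
  have := integrable_fin_num mA (integrable_funepos mA iXA).
  by under eq_integral do rewrite funeposE/= -EFin_max.
have ifinn : (\int[P]_(w in A) (Xneg w)%:E)%E \is a fin_num.
  have := integrable_fin_num mA (integrable_funeneg mA iXA).
  by under eq_integral do rewrite funenegE/= -EFin_max.
have := X0 FA; rewrite integralE.
under eq_integral do rewrite funeposE/= -EFin_max.
under [X in (_ - X)%E]eq_integral do rewrite funenegE/= -EFin_max.
by move/eqP; rewrite sube_eq ?fin_num_adde_defl// => /eqP; rewrite add0e.
Qed.

Let indicM A B (Z : T -> R) : measurable A -> measurable B ->
  (\int[P]_(w in A) (Z w * \1_B w)%:E = \int[P]_(w in A `&` B) (Z w)%:E)%E.
Proof.
move=> mA mB; rewrite integral_mkcondr; apply: eq_integral => w _.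
by rewrite patchE indicE; case: ifP; rewrite ?mulr1 ?mulr0.
Qed.

Let pull_out_ge0 A (h : T -> R) : F A -> measurable_wrt F h ->
  (forall w, 0 <= h w) ->
  (\int[P]_(w in A) (Xpos w * h w)%:E = \int[P]_(w in A) (Xneg w * h w)%:E)%E.
Proof.
move=> FA mh h0; have mA := sub_sigma_algebra_measurable sF FA.
pose k (Z : T -> R) (Z0 : forall w, 0 <= Z w) (w : T) :=
  weighted_dirac (NngNum (Z0 w)) (w : g_sigma_algebraType F).
have mk (Z : T -> R) Z0 (B : set (g_sigma_algebraType F)) :
    measurable_fun [set: T] Z -> measurable B ->
    measurable_fun A (fun w => k Z Z0 w B).
  rewrite sub_sigma_algebra_measurableE// => mZ FB.
  under eq_fun do rewrite weighted_diracE/=.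
  apply/measurable_funTS/measurable_EFinP/measurable_funM => //.
  by apply: measurable_indic; exact: sub_sigma_algebra_measurable FB.
have mh' : measurable_fun [set: g_sigma_algebraType F] (EFin \o h).
  exact/measurable_EFinP.
have /= := @eq_integral_mixture _ _ _ _ _ _ _ P P A A (k _ Xpos0) (k _ Xneg0)
  (EFin \o h) mA mA _ _ _ mh' _.
under eq_integral do rewrite integral_weighted_dirac//.
move=> ->.
- by apply: eq_integral => w _; rewrite integral_weighted_dirac.
- by move=> B mB; exact: mk.
- by move=> B mB; exact: mk.
- move=> B; rewrite sub_sigma_algebra_measurableE// => FB.
  under eq_integral do rewrite weighted_diracE/=.
  under [RHS]eq_integral do rewrite weighted_diracE/=.
  have mB := sub_sigma_algebra_measurable sF FB.
  by rewrite !indicM// XposXneg//; exact: sub_sigma_algebraI.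
- by move=> w; rewrite lee_fin.
Qed.

Let integrable_bounded A (h : T -> R) c : F A -> measurable_wrt F h ->
  (forall w, A w -> `|h w| <= c) ->
  P.-integrable A (fun w => (h w * X w)%:E).
Proof.
move=> FA mh hc; have mA := sub_sigma_algebra_measurable sF FA.
apply: (@le_integrable _ _ _ P _ _ _ (fun w => c%:E * (X w)%:E)%E) => //.
- apply/measurable_EFinP/measurable_funTS/measurable_funM => //.
  exact: measurable_wrtW mh.
- move=> w Aw; rewrite lee_fin !normrM ler_wpM2r//.
  by rewrite (le_trans (hc _ Aw))// ler_norm.
- by apply: integrableZl => //; exact: integrableS iX.
Qed.

(** A factor [h] known given [F] does not create correlation with a variable
    of zero conditional mean. Boundedness of [h] on [A] makes the
    product integrable. *)
Lemma cond_exp0_pull_out A (h : T -> R) c : F A -> measurable_wrt F h ->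
  (forall w, A w -> `|h w| <= c) ->
  P.-integrable A (fun w => (h w * X w)%:E) /\
  (\int[P]_(w in A) (h w * X w)%:E = 0)%E.
Proof.
move=> FA mh hc; split; first exact: integrable_bounded hc.
have mA := sub_sigma_algebra_measurable sF FA.
have ge0 (u : T -> R) : measurable_wrt F u -> (forall w, 0 <= u w) ->
    (forall w, A w -> `|u w| <= c) -> (\int[P]_(w in A) (u w * X w)%:E = 0)%E.
  move=> mu u0 uc; have iuX := integrable_bounded FA mu uc.
  have ifin := integrable_fin_num mA (integrable_funeneg mA iuX).
  rewrite integralE.
  have posE w : (fun w => (u w * X w)%:E)^\+%E w = (Xpos w * u w)%:E.
    by rewrite funeposE -EFin_max mulrC maxr_pMl// mul0r.
  have negE w : (fun w => (u w * X w)%:E)^\-%E w = (Xneg w * u w)%:E.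
    by rewrite funenegE -EFinN -EFin_max -mulrN mulrC maxr_pMl// mul0r.
  under [X in (X - _)%E]eq_integral do rewrite posE.
  rewrite pull_out_ge0//.
  rewrite -(@subee _ (\int[P]_(w in A) (Xneg w * u w)%:E)%E); last first.
    by move: ifin; under eq_integral do rewrite negE.
  by congr (_ - _)%E; apply: eq_integral => w _; rewrite negE.
pose hp w := Num.max (h w) 0; pose hn w := Num.max (- h w) 0.
have mhp : measurable_wrt F hp by exact: measurable_maxr.
have mhn : measurable_wrt F hn.
  by apply: measurable_maxr => //; exact: measurableT_comp.
have hpc w : A w -> `|hp w| <= c.
  move=> /hc; rewrite /hp; case: (leP (h w) 0) => //= _; rewrite normr0.
  exact: le_trans.
have hnc w : A w -> `|hn w| <= c.
  move=> /hc; rewrite -normrN /hn; case: (leP (- h w) 0) => //= _; rewrite normr0.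
  exact: le_trans.
transitivity (\int[P]_(w in A)
    ((fun w => (hp w * X w)%:E) \- (fun w => (hn w * X w)%:E)) w)%E.
  apply: eq_integral => w _ /=; rewrite -EFinB -mulrBl; congr (_ * _)%:E.
  by rewrite /hp /hn; case: (leP (h w) 0); case: (leP (- h w) 0); lra.
rewrite integralB//; last 2 first.
  - exact: integrable_bounded hpc.
  - exact: integrable_bounded hnc.
rewrite !ge0// ?sube0//.
- by move=> w; rewrite le_max lexx orbT.
- by move=> w; rewrite le_max lexx orbT.
Qed.

End pull_out.

Section conditional_law.
Context {disp : measure_display} {T : measurableType disp} {R : realType}.
Context {d : measure_display} {U : measurableType d}.
Variables (P : probability T R) (F : set (set T)).
Hypothesis sF : is_sub_sigma_algebra F.
Local Open Scope ereal_scope.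

(** The disintegration formula. It asks for measurability of [f \o X] and not of
    [X]: a random vector known through its coordinates is covered without an
    identification of the Borel sets of the product. This is why the comparison
    of mixtures takes place on the real line, after the laws are pushed
    forward by [f]. *)
Lemma integral_cond_law (X : T -> U) (k : T -> probability U R) A
    (f : U -> R) : is_cond_law P F X k -> F A ->
  measurable_fun [set: T] (f \o X) -> measurable_fun [set: U] f ->
  (forall x, (0 <= f x)%R) ->
  \int[P]_(w in A) (f (X w))%:E = \int[P]_(w in A) \int[k w]_x (f x)%:E.
Proof.
move=> [mk kE] FA mfX mf f0; have mA := sub_sigma_algebra_measurable sF FA.
have mfB B : measurable B -> measurable (f @^-1` B).
  by move=> mB; rewrite -[_ @^-1` _]setTI; exact: mf.
have mfXB B : measurable B -> measurable ((f \o X) @^-1` B).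
  by move=> mB; rewrite -[_ @^-1` _]setTI; exact: mfX.
(* The absolute value extends the identity of [0, +oo[ to a nonnegative
   function on the whole line. *)
have mabs : measurable_fun [set: R] (fun y => `|y|%:E).
  by apply/measurable_EFinP; exact: normr_measurable.
transitivity (\int[P]_(w in A) \int[\d_(f (X w))]_y `|y|%:E).
  apply: eq_integral => w _.
  by rewrite integral_dirac// diracT mul1e ger0_norm.
transitivity (\int[P]_(w in A) \int[pushforward (k w) f]_y `|y|%:E); last first.
  apply: eq_integral => w _; rewrite ge0_integral_pushforward//.
  by apply: eq_integral => x _ /=; rewrite ger0_norm.
apply: (@eq_integral_mixture _ _ _ _ _ _ _ P P A A (fun w => \d_(f (X w)))
  (fun w => pushforward (k w) f)) => //.
- move=> B mB.
  suff : measurable_fun A (EFin \o \1_((f \o X) @^-1` B) : T -> \bar R) by [].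
  exact/measurable_funTS/measurable_EFinP/measurable_indic/mfXB.
- move=> B mB; apply: measurable_funTS.
  exact: measurable_wrtW (mk _ (mfB _ mB)).
- move=> B mB.
  transitivity (\int[P]_(w in A) (\1_((f \o X) @^-1` B) w)%:E) => //.
  rewrite integral_indic//; last exact: mfXB.
  by rewrite setIC; apply: kE => //; exact: mfB.
Qed.

End conditional_law.

(** * Integration against a law *)

Section normal_integral.
Context {R : realType}.
Local Notation leb := (@lebesgue_measure R).
Local Open Scope ereal_scope.

Lemma integral_normal_prob (m s : R) (f : measurableTypeR R -> \bar R) :
  measurable_fun [set: measurableTypeR R] f -> (forall x, 0 <= f x) ->
  \int[normal_prob m s]_x f x = \int[leb]_x ((normal_pdf m s x)%:E * f x).
Proof.
move=> mf f0.
pose k (x : measurableTypeR R) :=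
  weighted_dirac (NngNum (normal_pdf_ge0 m s x)) x.
transitivity (\int[normal_prob m s]_x \int[\d_x]_y f y).
  by apply: eq_integral => x _; rewrite integral_dirac// diracT mul1e.
transitivity (\int[leb]_x \int[k x]_y f y); last first.
  by apply: eq_integral => x _; rewrite integral_weighted_dirac.
apply: (@eq_integral_mixture _ _ _ _ _ _ _ (normal_prob m s) leb setT setT
  (fun x => \d_x) k) => //.
- by move=> B mB; exact/measurable_EFinP/measurable_indic.
- move=> B mB; under eq_fun do rewrite weighted_diracE/=.
  apply/measurable_EFinP/measurable_funM; last exact: measurable_indic.
  exact: measurable_normal_pdf.
- move=> B mB; rewrite integral_indic// setIT /normal_prob.
  rewrite [LHS]integral_mkcond.
  apply: eq_integral => x _; rewrite weighted_diracE/= patchE indicE.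
  by case: ifP; rewrite ?mulr1 ?mulr0.
Qed.

End normal_integral.

Section law.
Context {R : realType}.
Local Open Scope ereal_scope.

Lemma integral_law d1 d2 (T : measurableType d1) (U : measurableType d2)
    (mu : {measure set T -> \bar R}) (nu : {measure set U -> \bar R})
    (X : T -> U) (f : U -> \bar R) :
  measurable_fun [set: T] X ->
  (forall B, measurable B -> mu (X @^-1` B) = nu B) ->
  measurable_fun [set: U] f -> (forall y, 0 <= f y) ->
  \int[mu]_x f (X x) = \int[nu]_y f y.
Proof.
move=> mX XE mf f0.
have mXB B : measurable B -> measurable (X @^-1` B).
  by move=> mB; rewrite -[_ @^-1` _]setTI; exact: mX.
transitivity (\int[mu]_x \int[\d_(X x)]_y f y).
  by apply: eq_integral => x _; rewrite integral_dirac// diracT mul1e.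
transitivity (\int[nu]_x \int[\d_x]_y f y); last first.
  by apply: eq_integral => x _; rewrite integral_dirac// diracT mul1e.
apply: eq_integral_mixture => // B mB.
- suff : measurable_fun setT (EFin \o \1_(X @^-1` B) : T -> \bar R) by [].
  exact/measurable_EFinP/measurable_indic/mXB.
- exact/measurable_EFinP/measurable_indic.
- transitivity (\int[mu]_x (\1_(X @^-1` B) x)%:E) => //.
  rewrite integral_indic//; last exact: mXB.
  by rewrite setIT XE// -[RHS]/(\int[nu]_y (\1_B y)%:E) integral_indic// setIT.
Qed.

End law.

(** * The Euclidean norm *)

Section euclidean_norm.
Context {R : realType} {d : nat}.
Implicit Types x y : 'rV[R]_d.

Lemma enorm_ge0 x : 0 <= enorm x. Proof. exact: sqrtr_ge0. Qed.

Lemma sqr_enorm x : enorm x ^+ 2 = \sum_(i < d) x 0 i ^+ 2.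
Proof. by rewrite sqr_sqrtr// sumr_ge0// => i _; exact: sqr_ge0. Qed.

Lemma normr_coord_le_enorm x i : `|x 0 i| <= enorm x.
Proof.
rewrite -ler_sqr ?nnegrE ?enorm_ge0// real_normK ?num_real// sqr_enorm.
by rewrite (bigD1 i)//= lerDl sumr_ge0// => j _; exact: sqr_ge0.
Qed.

Lemma sqr_enormD x y : enorm (x + y) ^+ 2 =
  enorm x ^+ 2 + \sum_(i < d) (2 * x 0 i) * y 0 i + enorm y ^+ 2.
Proof.
rewrite !sqr_enorm -!big_split/=; apply: eq_bigr => i _.
by rewrite mxE; ring.
Qed.

(** A weak triangle inequality, which follows from [(a + b)^2 <= 2 a^2 + 2 b^2]
    on each coordinate; the factor 2 only affects the final constant. *)
Lemma enormD_le x y : enorm (x + y) <= 2 * Num.max (enorm x) (enorm y).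
Proof.
have m0 : 0 <= Num.max (enorm x) (enorm y) by rewrite le_max enorm_ge0.
rewrite -ler_sqr ?nnegrE ?enorm_ge0 ?mulr_ge0//.
apply: (@le_trans _ _ (2 * (enorm x ^+ 2 + enorm y ^+ 2))).
  rewrite !sqr_enorm -big_split/= mulr_sumr; apply: ler_sum => i _.
  by rewrite mxE; have := sqr_ge0 (x 0 i - y 0 i); lra.
have xm : enorm x ^+ 2 <= Num.max (enorm x) (enorm y) ^+ 2.
  by rewrite ler_sqr ?nnegrE ?enorm_ge0// le_max lexx.
have ym : enorm y ^+ 2 <= Num.max (enorm x) (enorm y) ^+ 2.
  by rewrite ler_sqr ?nnegrE ?enorm_ge0// le_max lexx orbT.
by rewrite exprMn; lra.
Qed.

Lemma enormD_powR_le x y p : 0 <= p ->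
  enorm (x + y) `^ p <= 2 `^ p * (enorm x `^ p + enorm y `^ p).
Proof.
move=> p0.
have m0 : 0 <= Num.max (enorm x) (enorm y) by rewrite le_max enorm_ge0.
apply: (@le_trans _ _ ((2 * Num.max (enorm x) (enorm y)) `^ p)).
  by apply: ge0_ler_powR => //; rewrite ?nnegrE ?enorm_ge0 ?mulr_ge0// enormD_le.
rewrite powRM// ler_wpM2l ?powR_ge0//.
by case: (leP (enorm x) (enorm y)) => _; rewrite (lerDl, lerDr) powR_ge0.
Qed.

Lemma enorm_powR_le_sum x p : 0 < p ->
  enorm x `^ p <= d%:R `^ p * \sum_(i < d) `|x 0 i| `^ p.
Proof.
move=> p0; have [/existsP[i0 _]|] := boolP [exists i : 'I_d, true]; last first.
  move/existsPn => noi; rewrite /enorm big1 => [|i]; last by have := noi i.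
  rewrite sqrtr0 powR0 ?gt_eqF//; apply: mulr_ge0; first exact: powR_ge0.
  by apply: sumr_ge0 => i _; exact: powR_ge0.
(* The sum dominates its largest term, and that coordinate controls the norm up
   to the factor d. *)
pose j := [arg max_(j > i0) `|x 0 j|]%O.
have jmax i : `|x 0 i| <= `|x 0 j|.
  by rewrite /j; case: arg_maxP => // k _ /(_ i isT).
have d1 : 1 <= d%:R :> R by rewrite ler1n (leq_ltn_trans _ (ltn_ord i0)).
apply: (@le_trans _ _ ((d%:R * `|x 0 j|) `^ p)).
  apply: ge0_ler_powR => //; rewrite ?nnegrE ?enorm_ge0 ?mulr_ge0//.
    exact: ltW.
  rewrite -ler_sqr ?nnegrE ?enorm_ge0 ?mulr_ge0//.
  apply: (@le_trans _ _ (\sum_(i < d) `|x 0 j| ^+ 2)).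
    rewrite sqr_enorm; apply: ler_sum => i _.
    by rewrite -[_ ^+ 2]real_normK ?num_real// ler_sqr ?nnegrE.
  rewrite sumr_const card_ord exprMn -[leLHS]mulr_natl ler_wpM2r ?sqr_ge0//.
  by rewrite expr2 ler_peMl.
rewrite powRM// ler_wpM2l ?powR_ge0// (bigD1 j)//= lerDl.
by apply: sumr_ge0 => i _; exact: powR_ge0.
Qed.

End euclidean_norm.

Section euclidean_measurability.
Context {R : realType} {d : nat} {disp : measure_display}.
Context {T : measurableType disp}.

Lemma measurable_rV_coord (i : 'I_d) :
  measurable_fun [set: borel_rV R d] (rV_coord i : borel_rV R d -> R).
Proof.
apply: (measurability _ (RGenOpens.measurableE R)) => _ [_ [a [b ->] <-]].
rewrite setTI; apply: sub_sigma_algebra => /=.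
by apply: open_comp; [move=> x _; exact: coord_continuous|exact: interval_open].
Qed.

Lemma measurable_coord (f : T -> 'rV[R]_d) i D :
  measurable_fun D (f : T -> borel_rV R d) ->
  measurable_fun D (fun w => f w 0 i).
Proof. exact: (measurableT_comp (measurable_rV_coord i)). Qed.

Lemma measurable_fun_enorm (f : T -> 'rV[R]_d) D :
  (forall i, measurable_fun D (fun w => f w 0 i)) ->
  measurable_fun D (fun w => enorm (f w)).
Proof.
move=> mf; rewrite /enorm; apply: measurableT_comp => //=.
  apply: continuous_measurable_fun; exact: (@sqrt_continuous R).
by apply: measurable_sum => i; exact: measurable_funX.
Qed.

Lemma measurable_fun_enorm_powR (f : T -> 'rV[R]_d) p D :
  (forall i, measurable_fun D (fun w => f w 0 i)) ->
  measurable_fun D (fun w => enorm (f w) `^ p).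
Proof.
move=> mf; apply: (measurableT_comp (@measurable_powR _ p)).
exact: measurable_fun_enorm.
Qed.

Lemma measurable_fun_sqr_enorm (f : T -> 'rV[R]_d) D :
  (forall i, measurable_fun D (fun w => f w 0 i)) ->
  measurable_fun D (fun w => enorm (f w) ^+ 2).
Proof. by move=> mf; apply: measurable_funX; exact: measurable_fun_enorm. Qed.

Lemma measurable_comp_continuous (h : 'rV[R]_d -> 'rV[R]_d) (f : T -> 'rV[R]_d) :
  continuous h -> measurable_fun [set: T] (f : T -> borel_rV R d) ->
  measurable_fun [set: T] (h \o f : T -> borel_rV R d).
Proof.
move=> ch mf; apply: (measurableT_comp _ mf) => /=.
apply: (measurability _ (erefl : @measurable _ (borel_rV R d) = <<s open >>)).
move=> _ [B oB <-]; rewrite setTI; apply: sub_sigma_algebra.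
by move/continuousP: ch => /(_ _ oB).
Qed.

End euclidean_measurability.

(** * Conditional moments of a known vector plus centered noise *)

Section conditional_moments_of_sum.
Context {disp : measure_display} {T : measurableType disp} {R : realType}.
Context {d : nat}.
Variables (P : probability T R) (F : set (set T)).
Hypothesis sF : is_sub_sigma_algebra F.
Variables (h e : T -> 'rV[R]_d) (D : set T) (delta : R).
Hypothesis mh : forall i, measurable_wrt F (fun w => h w 0 i).
Hypothesis ie : forall i, P.-integrable [set: T] (fun w => (e w 0 i)%:E).
Hypothesis e0 : forall i A, F A -> (\int[P]_(w in A) (e w 0 i)%:E = 0)%E.
Hypothesis FD : F D.
Hypothesis hD : forall w, D w -> enorm (h w) <= delta.

Let mhT i : measurable_fun [set: T] (fun w => h w 0 i).
Proof. exact: measurable_wrtW (mh i). Qed.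

Let meT i : measurable_fun [set: T] (fun w => e w 0 i).
Proof. by have /measurable_int/measurable_EFinP := ie i. Qed.

Let mheT i : measurable_fun [set: T] (fun w => (h w + e w) 0 i).
Proof.
by under eq_fun do rewrite mxE; exact: measurable_funD.
Qed.

Lemma integral_enormD_powR_le p M A : 0 <= p -> F A -> A `<=` D ->
  (\int[P]_(w in A) (enorm (e w) `^ p)%:E <= M%:E * P A)%E ->
  (\int[P]_(w in A) (enorm (h w + e w) `^ p)%:E <=
    (2 `^ p * (delta `^ p + M))%:E * P A)%E.
Proof.
move=> p0 FA AD eM; have mA := sub_sigma_algebra_measurable sF FA.
have mep : measurable_fun A (fun w => (enorm (e w) `^ p)%:E).
  by apply/measurable_funTS/measurable_EFinP/measurable_fun_enorm_powR.
have mcep : measurable_fun A (fun w => (delta `^ p)%:E + (enorm (e w) `^ p)%:E)%E.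
  by apply: emeasurable_funD => //; exact: measurable_cst.
apply: (@le_trans _ _
  (\int[P]_(w in A) ((2 `^ p)%:E * ((delta `^ p)%:E + (enorm (e w) `^ p)%:E)))%E).
  apply: ge0_le_integral => //.
  - by move=> w _; rewrite lee_fin powR_ge0.
  - by apply/measurable_funTS/measurable_EFinP/measurable_fun_enorm_powR.
  - exact: measurable_funeM.
  - move=> w Aw; rewrite -EFinD -EFinM lee_fin.
    apply: (le_trans (enormD_powR_le _ _ p0)).
    rewrite ler_wpM2l ?powR_ge0// lerD2r ge0_ler_powR ?nnegrE ?enorm_ge0 ?hD//.
      by rewrite (le_trans (enorm_ge0 _) (hD (AD _ Aw))).
    exact: AD.
rewrite ge0_integralZl//; last first.
  by move=> w _; rewrite -EFinD lee_fin addr_ge0 ?powR_ge0.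
rewrite ge0_integralD//; last 2 first.
- by move=> w _; rewrite lee_fin powR_ge0.
- by move=> w _; rewrite lee_fin powR_ge0.
rewrite integral_cst// EFinM -muleA lee_wpmul2l ?lee_fin ?powR_ge0//.
by rewrite EFinD muleDl ?leeD2l ?fin_num_measure.
Qed.

(** Expanding the square, the cross term integrates to 0 because [h] is bounded
    and known and [e] is centered, and the square of [h] is nonnegative. The
    second moment of [e] may a priori be infinite, but the claim is only at
    stake when that of [h + e] is finite, and then the cross term can be
    subtracted from an integrable function. *)
Lemma integral_sqr_enormD_ge A : F A -> A `<=` D ->
  (\int[P]_(w in A) (enorm (e w) ^+ 2)%:E <=
   \int[P]_(w in A) (enorm (h w + e w) ^+ 2)%:E)%E.
Proof.
move=> FA AD; have mA := sub_sigma_algebra_measurable sF FA.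
have [->|finG] := eqVneq (\int[P]_(w in A) (enorm (h w + e w) ^+ 2)%:E)%E +oo%E.
  exact: leey.
have msq (f : T -> 'rV[R]_d) :
    (forall i, measurable_fun [set: T] (fun w => f w 0 i)) ->
    measurable_fun A (fun w => (enorm (f w) ^+ 2)%:E).
  by move=> mf; apply/measurable_funTS/measurable_EFinP/measurable_fun_sqr_enorm.
have iG : P.-integrable A (fun w => (enorm (h w + e w) ^+ 2)%:E).
  apply/integrableP; split; first exact: msq.
  under eq_integral do rewrite gee0_abs ?lee_fin ?sqr_ge0//.
  by rewrite ltey.
have cross i : P.-integrable A (fun w => ((2 * h w 0 i) * e w 0 i)%:E) /\
    (\int[P]_(w in A) ((2 * h w 0 i) * e w 0 i)%:E = 0)%E.
  apply: (@cond_exp0_pull_out _ _ _ P F sF (fun w => e w 0 i) (ie i)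
    (e0 i) _
    (fun w => 2 * h w 0 i) (2 * delta)) => //.
  - by apply: measurable_funM => //; exact: mh.
  - move=> w /AD/hD hw; rewrite normrM ger0_norm// ler_wpM2l//.
    exact: le_trans (normr_coord_le_enorm _ _) hw.
pose S w := (\sum_(i < d) ((2 * h w 0 i) * e w 0 i)%:E)%E.
have iS : P.-integrable A S.
  by apply: integrable_sum => // i _; have [] := cross i.
have S0 : (\int[P]_(w in A) S w = 0)%E.
  rewrite integral_sum//; last by move=> i; have [] := cross i.
  by rewrite big1// => i _; have [] := cross i.
have eS w : ((enorm (e w) ^+ 2)%:E <= (enorm (h w + e w) ^+ 2)%:E - S w)%E.
  rewrite /S sumEFin -EFinB lee_fin sqr_enormD.
  by have := sqr_ge0 (enorm (h w)); lra.
apply: (@le_trans _ _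
    (\int[P]_(w in A) ((enorm (h w + e w) ^+ 2)%:E - S w))%E).
  apply: ge0_le_integral => //.
  - by move=> w _; rewrite lee_fin sqr_ge0.
  - exact: msq.
  - apply: emeasurable_funB; [exact: msq|exact: measurable_int iS].
by rewrite integralB// S0 sube0.
Qed.

(** On [D] the numerator is at most [2^p (delta^p + M)] and the denominator at
    least [v]; off [D] both sides are 0. *)
Lemma cond_moment_ratio p M v : 0 <= delta -> 0 <= p -> 0 <= M -> 0 < v ->
  (forall A, F A -> A `<=` D ->
    (\int[P]_(w in A) (enorm (e w) `^ p)%:E <= M%:E * P A)%E) ->
  (forall A, F A -> A `<=` D ->
    (v%:E * P A <= \int[P]_(w in A) (enorm (e w) ^+ 2)%:E)%E) ->
  {ae P, forall w,
    ((\1_D w)%:E * cond_exp P F (fun w => (enorm (h w + e w) `^ p)%:E) w <=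
     (2 `^ p * (delta `^ p + M) / v)%:E *
       ((\1_D w)%:E * cond_exp P F (fun w => (enorm (h w + e w) ^+ 2)%:E) w))%E}.
Proof.
move=> delta0 p0 M0 v0 eM ev.
set K := 2 `^ p * (delta `^ p + M).
have K0 : 0 <= K by rewrite mulr_ge0 ?addr_ge0 ?powR_ge0.
have mp : measurable_fun [set: T] (fun w => (enorm (h w + e w) `^ p)%:E).
  by apply/measurable_EFinP/measurable_fun_enorm_powR.
have m2 : measurable_fun [set: T] (fun w => (enorm (h w + e w) ^+ 2)%:E).
  by apply/measurable_EFinP/measurable_fun_sqr_enorm.
have p_ge0 w : (0 <= (enorm (h w + e w) `^ p)%:E)%E by rewrite lee_fin powR_ge0.
have sq_ge0 w : (0 <= (enorm (h w + e w) ^+ 2)%:E)%E by rewrite lee_fin sqr_ge0.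
have upper := cond_exp_le_of_integral_le sF
  (cond_expP sF (or_intror (conj mp p_ge0))) FD K0
  (fun A FA AD => integral_enormD_powR_le p0 FA AD (eM A FA AD)).
have lower := cond_exp_ge_of_integral_ge sF sq_ge0
  (cond_expP sF (or_intror (conj m2 sq_ge0))) FD (ltW v0)
  (fun A FA AD => le_trans (ev A FA AD) (integral_sqr_enormD_ge FA AD)).
apply: filterS2 upper lower => w up lo.
rewrite indicE; case: (boolP (w \in D)) => [/[!inE] Dw|_]; last first.
  by rewrite !mul0e mule0.
rewrite !mul1e; apply: (le_trans (up Dw)).
have -> : K%:E = ((K / v)%:E * v%:E)%E by rewrite -EFinM divfK ?gt_eqF.
by rewrite lee_wpmul2l ?lee_fin ?divr_ge0 ?(ltW v0)// lo.
Qed.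

End conditional_moments_of_sum.

(** * Moments of normal variables *)

Section normal_variable.
Context {R : realType} {disp : measure_display} {T : measurableType disp}.
Variables (P : probability T R) (X : T -> R) (m s : R).
Hypothesis mX : measurable_fun [set: T] X.
Hypothesis lawX : forall B : set R, measurable B ->
  P (X @^-1` B) = normal_law m s B.

Lemma integral_normal_law0 (f : R -> \bar R) : s = 0 ->
  measurable_fun [set: R] f -> (forall x, 0 <= f x)%E ->
  (\int[P]_w f (X w) = f m)%E.
Proof.
move=> s0 mf f0.
rewrite (@integral_law _ _ _ _ (measurableTypeR R) P
  (\d_(m : measurableTypeR R)) (X : T -> measurableTypeR R) f)//.
  by rewrite integral_dirac// diracT mul1e.
move=> B mB; transitivity (normal_law m s B); first exact: lawX.
by rewrite /normal_law s0 eqxx.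
Qed.

Lemma integral_normal_law (f : R -> \bar R) : s != 0 ->
  measurable_fun [set: R] f -> (forall x, 0 <= f x)%E ->
  (\int[P]_w f (X w) =
   \int[@lebesgue_measure R]_x ((normal_pdf m s x)%:E * f x))%E.
Proof.
move=> s0 mf f0.
rewrite (@integral_law _ _ _ _ (measurableTypeR R) P
  (normal_prob m s) (X : T -> measurableTypeR R) f)//.
  exact: integral_normal_prob.
move=> B mB; transitivity (normal_law m s B); first exact: lawX.
by rewrite /normal_law (negbTE s0).
Qed.

(** Completing the square, [exp (t x)] times the density with mean [m] is a
    constant times the density with mean [m + s^2 t]. The formula also covers
    the point mass [s = 0]. *)
Lemma normal_mgf t :
  (\int[P]_w (expR (t * X w))%:E = (expR (m * t + s ^+ 2 * t ^+ 2 / 2))%:E)%E.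
Proof.
have mexp : measurable_fun [set: R] (fun x => (expR (t * x))%:E).
  by apply/measurable_EFinP; apply: measurableT_comp.
have exp0 x : (0 <= (expR (t * x))%:E)%E by rewrite lee_fin expR_ge0.
have [s0|s0] := eqVneq s 0.
  rewrite (integral_normal_law0 (f := fun x => (expR (t * x))%:E))//.
  by rewrite s0 expr0n/= !mul0r addr0 mulrC.
rewrite (integral_normal_law (f := fun x => (expR (t * x))%:E))//.
under eq_integral => x _.
  rewrite -EFinM (_ : normal_pdf m s x * _ = expR (m * t + s ^+ 2 * t ^+ 2 / 2) *
                              normal_pdf (m + s ^+ 2 * t) s x); last first.
    rewrite /normal_pdf (negbTE s0) /normal_fun -[LHS]mulrA [RHS]mulrCA -!expRD.
    by congr (_ * expR _); field.
  rewrite EFinM; over.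
rewrite ge0_integralZl//=.
- by rewrite integral_normal_pdf mule1.
- by apply/measurable_EFinP; exact: measurable_normal_pdf.
- by move=> x _; rewrite lee_fin normal_pdf_ge0.
Qed.

(** The density is at most [1 / (2 |s|)], so an interval of length [|s|] carries
    at most half of the mass and the other half lies at distance at least
    [|s| / 2] from the origin. This crude inequality is all that is needed to
    bound [s] by the variance. *)
Lemma normal_second_moment_ge :
  ((s ^+ 2 / 8)%:E <= \int[P]_w (X w ^+ 2)%:E)%E.
Proof.
have [s0|s0] := eqVneq s 0.
  by rewrite s0 expr0n/= mul0r integral_ge0// => w _; rewrite lee_fin sqr_ge0.
pose a := `|s| / 2; pose B : set R := `[(- a), a]%classic.
have mB : measurable B by exact: measurable_itv.
have a0 : 0 < a by rewrite divr_gt0// normr_gt0.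
have peak : normal_peak s * (2 * a) <= 1 / 2.
  have sqpi : 2 * `|s| <= Num.sqrt (s ^+ 2 * pi *+ 2).
    rewrite -[leLHS]ger0_norm ?mulr_ge0// -sqrtr_sqr ler_wsqrtr//.
    rewrite exprMn real_normK ?num_real// -mulr_natr.
    have := pi_ge2 R; have := sqr_ge0 s; nra.
  have s1 : 0 < Num.sqrt (s ^+ 2 * pi *+ 2).
    by apply: lt_le_trans sqpi; rewrite mulr_gt0// normr_gt0.
  by rewrite /normal_peak /a mulrC ler_pdivrMr//; lra.
have leB : @lebesgue_measure R B = (2 * a)%:E.
  rewrite /B lebesgue_measure_itv/= lte_fin ifT; last by lra.
  by rewrite -EFinB; congr EFin; ring.
have PB : (P (X @^-1` B) <= (1 / 2)%:E)%E.
  rewrite lawX// /normal_law (negbTE s0) /normal_prob.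
  apply: (@le_trans _ _
    (\int[@lebesgue_measure R]_(x in B) (normal_peak s)%:E)%E).
    apply: ge0_le_integral => //.
    - by move=> x _; rewrite lee_fin normal_pdf_ge0.
    - by apply/measurable_funTS/measurable_EFinP; exact: measurable_normal_pdf.
    - by move=> x _; rewrite lee_fin normal_pdf_ub.
  rewrite integral_cst// [X in (_ * X)%E](_ : _ = (2 * a)%:E); last exact: leB.
  by rewrite -EFinM lee_fin.
have mXB : measurable (X @^-1` B) by rewrite -[_ @^-1` _]setTI; exact: mX.
have key : ((a ^+ 2)%:E <=
    \int[P]_w (X w ^+ 2)%:E + (a ^+ 2)%:E * P (X @^-1` B))%E.
  have -> : ((a ^+ 2)%:E * P (X @^-1` B) =
      \int[P]_w ((a ^+ 2)%:E * (\1_(X @^-1` B) w)%:E))%E.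
    rewrite ge0_integralZl//; last 2 first.
    - by apply/measurable_EFinP/measurable_indic.
    - by rewrite lee_fin sqr_ge0.
    by rewrite integral_indic// setIT.
  rewrite -ge0_integralD//; last 4 first.
  - by move=> w _; rewrite lee_fin sqr_ge0.
  - by apply/measurable_EFinP; exact: measurable_funX.
  - by move=> w _; rewrite -EFinM lee_fin mulr_ge0 ?sqr_ge0.
  - by apply: measurable_funeM; apply/measurable_EFinP/measurable_indic.
  have intc : (\int[P]_w (a ^+ 2)%:E = (a ^+ 2)%:E)%E.
    rewrite integral_cst// [X in (_ * X)%E](_ : _ = 1%E) ?mule1//.
    exact: probability_setT.
  rewrite -[leLHS]intc; apply: ge0_le_integral => //.
  - by move=> w _; rewrite lee_fin sqr_ge0.
  - apply: emeasurable_funD.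
    + by apply/measurable_EFinP; exact: measurable_funX.
    + by apply: measurable_funeM; apply/measurable_EFinP/measurable_indic.
  - move=> w _; rewrite -EFinM -EFinD lee_fin indicE.
    have [wB|] := boolP (w \in X @^-1` B); first by rewrite mulr1 lerDr sqr_ge0.
    rewrite mulr0 addr0 notin_setE /B/= in_itv/= => /negP.
    rewrite -ler_norml -ltNge => /ltW aX.
    by rewrite -[leRHS]real_normK ?num_real// ler_sqr ?nnegrE// ltW.
have a2 : a ^+ 2 = s ^+ 2 / 4.
  by rewrite /a exprMn real_normK ?num_real//; field.
have Pfin : P (X @^-1` B) \is a fin_num by exact: fin_num_measure.
have [->|Ifin] := eqVneq (\int[P]_w (X w ^+ 2)%:E)%E +oo%E; first exact: leey.
have {}Ifin : (\int[P]_w (X w ^+ 2)%:E)%E \is a fin_num.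
  by rewrite ge0_fin_numE ?ltey// integral_ge0// => w _; rewrite lee_fin sqr_ge0.
move: key PB; rewrite -(fineK Pfin) -(fineK Ifin) -EFinM -EFinD !lee_fin a2.
by have := sqr_ge0 s; nra.
Qed.

End normal_variable.

Section centered_normal_variable.
Context {R : realType}.

(** Apply [u <= exp u] to [u = y / p] and raise to the power [p]. *)
Lemma powR_le_expR (y p : R) : 0 <= y -> 0 < p -> y `^ p <= p `^ p * expR y.
Proof.
move=> y0 p0.
have -> : p `^ p * expR y = (p * expR (y / p)) `^ p.
  by rewrite powRM ?expR_ge0 ?(ltW p0)// -expRM divfK ?gt_eqF.
rewrite ge0_ler_powR ?nnegrE ?mulr_ge0 ?expR_ge0 ?(ltW p0)//.
rewrite mulrC -ler_pdivrMr//; apply: le_trans (expR_ge1Dx _).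
by rewrite lerDr.
Qed.

Lemma expR_normr_le (x : R) : expR `|x| <= expR x + expR (- x).
Proof. by case: (ger0P x) => _; rewrite (lerDl, lerDr) expR_ge0. Qed.

Lemma normr_powR_le_expR (x p : R) : 0 < p ->
  `|x| `^ p <= p `^ p * (expR x + expR (- x)).
Proof.
move=> p0; apply: (le_trans (powR_le_expR (normr_ge0 x) p0)).
by rewrite ler_wpM2l ?powR_ge0// expR_normr_le.
Qed.

Lemma sqr_le_expR (x : R) : x ^+ 2 <= 2 `^ 2 * (expR x + expR (- x)).
Proof.
rewrite -[leLHS]real_normK ?num_real// -powR_mulrn//.
exact: normr_powR_le_expR.
Qed.

Context {disp : measure_display} {T : measurableType disp}.
Variables (P : probability T R) (X : T -> R) (m s : R).
Hypothesis mX : measurable_fun [set: T] X.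
Hypothesis lawX : forall B : set R, measurable B ->
  P (X @^-1` B) = normal_law m s B.

Lemma normal_two_sided_mgf :
  (\int[P]_w (expR (X w) + expR (- X w))%:E =
   (expR (m + s ^+ 2 / 2) + expR (- m + s ^+ 2 / 2))%:E)%E.
Proof.
have mgf1 := normal_mgf mX lawX 1; have mgfN1 := normal_mgf mX lawX (-1).
under eq_integral do rewrite EFinD.
rewrite ge0_integralD//; last 2 first.
- by apply/measurable_EFinP; apply: measurableT_comp.
- by apply/measurable_EFinP; do 2 apply: measurableT_comp => //.
rewrite EFinD; congr (_ + _)%E.
  under eq_integral do rewrite -[X _]mul1r.
  by rewrite mgf1; congr (expR _)%:E; field.
under eq_integral do rewrite -mulN1r.
by rewrite mgfN1; congr (expR _)%:E; field.
Qed.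

Lemma normal_integrable : P.-integrable [set: T] (EFin \o X).
Proof.
apply: (@le_integrable _ _ _ P _ measurableT _
  (fun w => (expR (X w) + expR (- X w))%:E)).
- exact/measurable_EFinP.
- move=> w _; rewrite lee_fin [leRHS]ger0_norm ?addr_ge0 ?expR_ge0//.
  apply: (@le_trans _ _ (expR `|X w|)).
    by apply: le_trans (expR_ge1Dx _); rewrite lerDr.
  exact: expR_normr_le.
- apply/integrableP; split.
    apply/measurable_EFinP; apply: measurable_funD; first exact: measurableT_comp.
    by do 2 apply: measurableT_comp => //.
  under eq_integral do rewrite /= ger0_norm ?addr_ge0 ?expR_ge0//.
  by rewrite normal_two_sided_mgf ltry.
Qed.

Hypothesis X0 : ('E_P[X] = 0)%E.

(** The parameter [m] is recovered from the moment generating function: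
    [exp (t x) >= 1 + t x] integrates to [exp (m t + s^2 t^2 / 2) >= 1] for every
    [t], so the exponent, which vanishes at [t = 0], has its minimum there. *)
Lemma centered_normal_mean0 : m = 0.
Proof.
have mgf_ge1 t : 0 <= m * t + s ^+ 2 * t ^+ 2 / 2.
  rewrite -[leRHS]expRK -ln1 ler_ln ?posrE ?expR_gt0// -lee_fin.
  rewrite -(normal_mgf mX lawX).
  have -> : 1%:E = (\int[P]_w (1 + t%:E * (X w)%:E))%E.
    rewrite integralD//; last 2 first.
    - exact: finite_measure_integrable_cst.
    - by apply: integrableZl => //; exact: normal_integrable.
    rewrite integralZl//; last exact: normal_integrable.
    move: X0; rewrite unlock => ->; rewrite mule0 adde0 integral_cst//.
    by rewrite [X in (_ * X)%E](_ : _ = 1%E) ?mule1//; exact: probability_setT.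
  apply: le_integral => //.
  - apply: integrableD => //; first exact: finite_measure_integrable_cst.
    by apply: integrableZl => //; exact: normal_integrable.
  - apply/integrableP; split.
      by apply/measurable_EFinP; do 2 apply: measurableT_comp => //.
    under eq_integral do rewrite /= ger0_norm ?expR_ge0//.
    by rewrite (normal_mgf mX lawX) ltry.
  - by move=> w _; rewrite -EFinM -EFinD lee_fin expR_ge1Dx.
have q0 : 0 < s ^+ 2 + 1 by rewrite ltr_wpDl// sqr_ge0.
(* The minimiser is - m / s^2; adding 1 to the denominator covers s = 0. *)
have := mgf_ge1 (- m / (s ^+ 2 + 1)).
have -> : m * (- m / (s ^+ 2 + 1)) + s ^+ 2 * (- m / (s ^+ 2 + 1)) ^+ 2 / 2 =
    - (m ^+ 2 * ((s ^+ 2 + 2) / (2 * (s ^+ 2 + 1) ^+ 2))).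
  by field; rewrite gt_eqF.
rewrite oppr_ge0 pmulr_lle0; last first.
  by rewrite divr_gt0 ?mulr_gt0 ?exprn_gt0// ltr_wpDl// sqr_ge0.
by move=> m2; apply/eqP; rewrite -sqrf_eq0 eq_le m2 sqr_ge0.
Qed.

Lemma normal_sqr_integrable : P.-integrable [set: T] (fun w => (X w ^+ 2)%:E).
Proof.
apply: (@le_integrable _ _ _ P _ measurableT _
  (fun w => (2 `^ 2)%:E * (expR (X w) + expR (- X w))%:E)%E).
- by apply/measurable_EFinP; exact: measurable_funX.
- move=> w _; rewrite -EFinM lee_fin ger0_norm ?sqr_ge0//.
  by rewrite (le_trans (sqr_le_expR _))// ler_norm.
- apply: integrableZl => //; apply/integrableP; split.
    apply/measurable_EFinP; apply: measurable_funD; first exact: measurableT_comp.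
    by do 2 apply: measurableT_comp => //.
  under eq_integral do rewrite /= ger0_norm ?addr_ge0 ?expR_ge0//.
  by rewrite normal_two_sided_mgf ltry.
Qed.

(** The power is dominated by [exp x + exp (- x)], whose integral is
    [2 exp (s^2 / 2)], and [s^2 <= 8 C]. *)
Lemma centered_normal_moment_le p C : 0 < p ->
  (\int[P]_w (X w ^+ 2)%:E <= C%:E)%E ->
  (\int[P]_w (`|X w| `^ p)%:E <= (p `^ p * (2 * expR (4 * C)))%:E)%E.
Proof.
move=> p0 XC.
have s2C : s ^+ 2 / 8 <= C.
  by rewrite -lee_fin (le_trans (normal_second_moment_ge mX lawX)).
have mexp : measurable_fun [set: T] (fun w => (expR (X w) + expR (- X w))%:E).
  apply/measurable_EFinP; apply: measurable_funD; first exact: measurableT_comp.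
  by do 2 apply: measurableT_comp => //.
apply: (@le_trans _ _
    (\int[P]_w ((p `^ p)%:E * (expR (X w) + expR (- X w))%:E))%E).
  apply: ge0_le_integral => //.
  - apply/measurable_EFinP; apply: (measurableT_comp (@measurable_powR _ p)).
    exact: measurableT_comp.
  - exact: measurable_funeM.
  - by move=> w _; rewrite -EFinM lee_fin normr_powR_le_expR.
rewrite ge0_integralZl ?lee_fin ?powR_ge0//.
rewrite normal_two_sided_mgf -EFinM lee_fin ler_wpM2l ?powR_ge0//.
rewrite centered_normal_mean0 oppr0 !add0r.
have : expR (s ^+ 2 / 2) <= expR (4 * C) by rewrite ler_expR; lra.
by lra.
Qed.

End centered_normal_variable.

(** * Moments of Gaussian vectors *)

Section gaussian_moments.
Context {R : realType} {d : nat}.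

Lemma normr_entry_le (m n : nat) (A : 'M[R]_(m, n)) i j : `|A i j| <= `|A|.
Proof.
by rewrite [leRHS]/Num.norm /= mx_normrE; apply/bigmax_geP; right; exists (i, j).
Qed.

Variable mu : probability (borel_rV R d) R.
Hypotheses (gmu : gaussian_vector mu) (cmu : centered mu).

Let mcoord i : measurable_fun [set: borel_rV R d]
  (rV_coord i : borel_rV R d -> R) := @measurable_rV_coord R d i.

Lemma gaussian_coord_law i : exists m s : R, forall B : set R, measurable B ->
  mu ((rV_coord i : borel_rV R d -> R) @^-1` B) = normal_law m s B.
Proof.
have [m [s law]] := gmu (delta_mx ord0 i); exists m, s => B mB.
rewrite -law//; congr (mu _); apply/seteqP; split => x /=;
  by rewrite /rV_coord (bigD1 i)//= big1 => [|j ji];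
     rewrite !mxE !eqxx ?(negbTE ji) ?mul0r ?addr0 ?mul1r.
Qed.

Lemma centered_covE i :
  ((cov_mx mu i i)%:E = \int[mu]_x (x ord0 i ^+ 2)%:E)%E.
Proof.
have [m [s law]] := gaussian_coord_law i.
have sqi := normal_sqr_integrable (mcoord i) law.
rewrite mxE unlock cmu /= unlock.
rewrite (_ : (fun x => _) = (fun x : borel_rV R d => (x ord0 i ^+ 2)%:E)).
  by rewrite fineK//; exact: integrable_fin_num sqi.
by apply/funext => x; rewrite !fctE /cst /rV_coord /= subr0 expr2.
Qed.

Lemma gaussian_enorm_powR_le p C : 0 < p -> `|cov_mx mu| <= C ->
  (\int[mu]_x (enorm x `^ p)%:E <=
   (d%:R `^ p * (d%:R * (p `^ p * (2 * expR (4 * C)))))%:E)%E.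
Proof.
move=> p0 covC.
have mabs i : measurable_fun [set: borel_rV R d]
    (fun x : borel_rV R d => (`|x ord0 i| `^ p)%:E).
  apply/measurable_EFinP; apply: (measurableT_comp (@measurable_powR _ p)).
  exact: measurableT_comp (mcoord i).
apply: (@le_trans _ _ (\int[mu]_x
    ((d%:R `^ p)%:E * \sum_(i < d) (`|x ord0 i| `^ p)%:E))%E).
  apply: ge0_le_integral => //.
  - by move=> x _; rewrite lee_fin powR_ge0.
  - by apply/measurable_EFinP/measurable_fun_enorm_powR => i; exact: mcoord.
  - by apply: measurable_funeM; exact: emeasurable_sum.
  - by move=> x _; rewrite sumEFin -EFinM lee_fin enorm_powR_le_sum.
rewrite ge0_integralZl//; last 2 first.
- exact: emeasurable_sum.
- by move=> x _; apply: sume_ge0 => i _; rewrite lee_fin powR_ge0.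
rewrite ge0_integral_sum//.
rewrite EFinM lee_wpmul2l ?lee_fin ?powR_ge0//.
apply: (@le_trans _ _ (\sum_(i < d) (p `^ p * (2 * expR (4 * C)))%:E)%E).
  apply: lee_sum => i _; have [m [s law]] := gaussian_coord_law i.
  apply: (centered_normal_moment_le (mcoord i) law (cmu i) p0).
  rewrite -centered_covE lee_fin (le_trans _ covC)//.
  exact: le_trans (ler_norm _) (normr_entry_le _ _ _).
by rewrite sumEFin sumr_const card_ord -[_ *+ d]mulr_natl.
Qed.

Lemma gaussian_sqr_enorm :
  (\int[mu]_x (enorm x ^+ 2)%:E = (\tr (cov_mx mu))%:E)%E.
Proof.
under eq_integral do rewrite sqr_enorm -sumEFin.
rewrite ge0_integral_sum//; last first.
- by move=> i x _; rewrite lee_fin sqr_ge0.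
- by move=> i; apply/measurable_EFinP/measurable_funX; exact: mcoord.
by rewrite /mxtrace -sumEFin; apply: eq_bigr => i _; rewrite centered_covE.
Qed.

End gaussian_moments.

(** * The local conditional relative-moment condition *)

Theorem proposition2 (R : realType) (d : nat)
    (disp : measure_display) (T : measurableType disp) (P : probability T R)
    (g : 'rV[R]_d -> R) (F : nat -> set (set T))
    (theta G eps : nat -> T -> 'rV[R]_d) (delta0 rho : R) :
  0 < delta0 -> 0 < rho ->
  continuously_differentiable g ->
  filtration F ->
  (forall n, (0 < n)%N ->
    measurable_wrt (F n.-1) (theta n : T -> borel_rV R d)) ->
  (forall n, (0 < n)%N -> measurable_wrt (F n) (G n : T -> borel_rV R d)) ->
  (forall n, (0 < n)%N -> forall w, G n w = grad g (theta n w) + eps n w) ->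
  (forall n, (0 < n)%N -> forall i : 'I_d,
    P.-integrable [set: T] (fun w => (eps n w 0 i)%:E) /\
    {ae P, forall w, cond_exp_prev P F n (fun w => eps n w 0 i) w = 0%E}) ->
  (forall M v0 : R, 0 < v0 ->
    (forall n, (0 < n)%N ->
      {ae P, forall w, local_event g theta delta0 n w ->
        (cond_exp_prev P F n (fun w => enorm (eps n w) `^ (2 + rho))%R w
           <= M%:E)%E /\
        (v0%:E <= cond_exp_prev P F n (fun w => enorm (eps n w) ^+ 2)%R w)%E}) ->
    local_relative_moment_condition P F g theta G delta0 rho)
  /\
  (forall (k : nat -> T -> probability (borel_rV R d) R) (C c : R), 0 < c ->
    (forall n, (0 < n)%N ->
      is_cond_law P (F n.-1) (eps n : T -> borel_rV R d) (k n)) ->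
    (forall n, (0 < n)%N -> {ae P, forall w,
      [/\ gaussian_vector (k n w), centered (k n w) &
          local_event g theta delta0 n w ->
          `|cov_mx (k n w)| <= C /\ c <= \tr (cov_mx (k n w))]}) ->
    local_relative_moment_condition P F g theta G delta0 rho).
Proof.
move=> delta0_gt0 rho_gt0 [_ cgrad] filtF mtheta _ GE eps0.
have sF n : is_sub_sigma_algebra (F n) := filtF.1 n.
have p_gt0 : 0 < 2 + rho by rewrite addr_gt0.
have mgrad n i : (0 < n)%N ->
    measurable_wrt (F n.-1) (fun w => grad g (theta n w) 0 i).
  move=> n0; apply: measurable_coord.
  exact: (measurable_comp_continuous cgrad (mtheta _ n0)).
have meps n i : (0 < n)%N -> measurable_fun [set: T] (fun w => eps n w 0 i).
  by move=> n0; have [/measurable_int/measurable_EFinP] := eps0 _ n0 i.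
have eps_orth n i A : (0 < n)%N -> F n.-1 A ->
    (\int[P]_(w in A) (eps n w 0 i)%:E = 0)%E.
  move=> n0 FA; have mA := sub_sigma_algebra_measurable (sF _) FA.
  have [ieps condeps0] := eps0 _ n0 i.
  have [mY YE] := cond_expP (sF n.-1) (or_introl ieps).
  rewrite -(YE _ FA) -(integral0 P A); apply: ae_eq_integral => //.
  - exact: measurable_funTS (measurable_wrtW (sF _) mY).
  - by apply: filterS condeps0 => w Y0 _; exact: Y0.
have local_event_F n : (0 < n)%N -> F n.-1 (local_event g theta delta0 n).
  move=> n0; rewrite (_ : local_event _ _ _ _ =
    (fun w => enorm (grad g (theta n w))) @^-1` `]-oo, delta0]%classic).
    apply: (measurable_wrt_preimage (sF _)) => //.
    by apply: measurable_fun_enorm => i; exact: mgrad.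
  by apply/seteqP; split => w /=; rewrite in_itv/=.
(* Both claims reduce to moment bounds over the events of F_(n-1) contained in
   the local event, with constants that do not depend on n. *)
have reduction M v : 0 <= M -> 0 < v ->
    (forall n, (0 < n)%N -> forall A, F n.-1 A ->
      A `<=` local_event g theta delta0 n ->
      (\int[P]_(w in A) (enorm (eps n w) `^ (2 + rho))%:E <= M%:E * P A)%E /\
      (v%:E * P A <= \int[P]_(w in A) (enorm (eps n w) ^+ 2)%:E)%E) ->
    local_relative_moment_condition P F g theta G delta0 rho.
  move=> M0 v0 bound.
  exists (2 `^ (2 + rho) * (delta0 `^ (2 + rho) + M) / v).
  apply: ae_foralln => n; have [->|] := posnP n; first exact: aeW.
  move=> n0; rewrite /cond_exp_prev (_ : G n =
    fun w => grad g (theta n w) + eps n w).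
    have := @cond_moment_ratio _ T R d P (F n.-1) (sF _)
      (fun w => grad g (theta n w)) (eps n) (local_event g theta delta0 n)
      delta0 (fun i => mgrad n i n0) (fun i => (eps0 _ n0 i).1)
      (fun i A => eps_orth n i A n0) (local_event_F _ n0) (fun w => id)
      (2 + rho) M v (ltW delta0_gt0) (ltW p_gt0) M0 v0
      (fun A FA AL => (bound n n0 A FA AL).1)
      (fun A FA AL => (bound n n0 A FA AL).2).
    by apply: filterS => w + _.
  by apply/funext => w; exact: GE.
split.
- move=> M v0 v0_gt0 bound; apply: (reduction `|M| v0) => // n n0 A FA AL.
  have [mp pge0] : measurable_fun [set: T]
      (fun w => (enorm (eps n w) `^ (2 + rho))%:E) /\
      forall w, (0 <= (enorm (eps n w) `^ (2 + rho))%:E)%E.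
    split; last by move=> w; rewrite lee_fin powR_ge0.
    by apply/measurable_EFinP/measurable_fun_enorm_powR => i; exact: meps.
  have [m2 sqge0] : measurable_fun [set: T]
      (fun w => (enorm (eps n w) ^+ 2)%:E) /\
      forall w, (0 <= (enorm (eps n w) ^+ 2)%:E)%E.
    split; last by move=> w; rewrite lee_fin sqr_ge0.
    by apply/measurable_EFinP/measurable_fun_sqr_enorm => i; exact: meps.
  split.
  + apply: (integral_le_of_cond_exp_le (sF n.-1) pge0
      (cond_expP (sF _) (or_intror (conj mp pge0))) _ _ FA AL) => //.
    apply: filterS (bound _ n0) => w + Lw => /(_ Lw) [+ _].
    by move=> /le_trans; apply; rewrite lee_fin ler_norm.
  + apply: (integral_ge_of_cond_exp_ge (sF n.-1) sqge0
      (cond_expP (sF _) (or_intror (conj m2 sqge0))) _ _ FA AL) => //.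
      exact: ltW.
    by apply: filterS (bound _ n0) => w + Lw => /(_ Lw) [_].
- move=> k C c c_gt0 klaw kgauss.
  pose p := 2 + rho.
  pose M := d%:R `^ p * (d%:R * (p `^ p * (2 * expR (4 * C)))).
  have M0 : 0 <= M by rewrite !mulr_ge0 ?powR_ge0 ?expR_ge0.
  apply: (reduction M c) => // n n0 A FA AL.
  have mA := sub_sigma_algebra_measurable (sF _) FA.
  have mcoord i := @measurable_rV_coord R d i.
  have mkint (f : 'rV[R]_d -> R) : (forall x, 0 <= f x) ->
      measurable_fun [set: borel_rV R d] f ->
      measurable_fun A (fun w => \int[k n w]_x (f x)%:E)%E.
    move=> f0 mf; apply: measurable_funTS.
    apply: (@measurable_fun_integral_kernel _ _ T (borel_rV R d) R (k n) _
      (fun x => (f x)%:E)).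
    - by move=> B mB; have := measurable_wrtW (sF n.-1) ((klaw _ n0).1 _ mB).
    - by move=> x; rewrite lee_fin.
    - exact/measurable_EFinP.
  split.
  + rewrite (integral_cond_law (f := fun x : borel_rV R d => @enorm R d x `^ p)
      (sF n.-1) (klaw _ n0) FA).
    * rewrite -integral_cst//; apply: ae_ge0_le_integral => //.
      - by move=> w _; apply: integral_ge0 => x _; rewrite lee_fin powR_ge0.
      - apply: mkint; first by move=> x; exact: powR_ge0.
        by apply: measurable_fun_enorm_powR => i; exact: mcoord.
      - apply: filterS (kgauss _ n0) => w [gk ck covk] /AL/covk[covC _].
        exact: gaussian_enorm_powR_le.
    * by apply: measurable_fun_enorm_powR => i; exact: meps.
    * by apply: measurable_fun_enorm_powR => i; exact: mcoord.
    * by move=> x; exact: powR_ge0.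
  + rewrite (integral_cond_law (f := fun x : borel_rV R d => @enorm R d x ^+ 2)
      (sF n.-1) (klaw _ n0) FA).
    * rewrite -integral_cst//; apply: ae_ge0_le_integral => //.
      - by move=> w _; rewrite lee_fin ltW.
      - by move=> w _; apply: integral_ge0 => x _; rewrite lee_fin sqr_ge0.
      - apply: mkint; first by move=> x; exact: sqr_ge0.
        by apply: measurable_fun_sqr_enorm => i; exact: mcoord.
      - apply: filterS (kgauss _ n0) => w [gk ck covk] /AL/covk[_ ctr].
        by rewrite gaussian_sqr_enorm// lee_fin.
    * by apply: measurable_fun_sqr_enorm => i; exact: meps.
    * by apply: measurable_fun_sqr_enorm => i; exact: mcoord.
    * by move=> x; exact: sqr_ge0.
Qed.
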